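(* For all integers $n\geq 0$ and $q\geq 2$, $$\sum_{i=0}^{q-1}\binom{q-1}{i}\frac{B_{q+i}\,G_{2n+q-i}}{(q+i)(2n+q-i)}+\frac14\sum_{i=0}^{2n}(-1)^i\binom{2n}{i}\frac{G_{q+i}\,G_{2n+q-i}}{(q+i)(2n+q-i)}=\frac{(-1)^q}{q\binom{2q}{q}}\cdot\frac{G_{2n+2q}}{2n+2q}.$$
   Context: $B_n$ are the Bernoulli numbers, defined by $\frac{t}{e^t-1}=\sum_{n=0}^\infty B_n\frac{t^n}{n!}$, and $G_n$ are the Genocchi numbers, defined by $\frac{2t}{e^t+1}=\sum_{n=1}^\infty G_n\frac{t^n}{n!}$; thus $G_n=2(1-2^n)B_n$ for $n\ge 0$ (with $G_0=0$). *)

(* Defs.v *)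
From mathcomp Require Import all_boot all_order all_algebra.
Set Implicit Arguments. Unset Strict Implicit. Unset Printing Implicit Defensive.
Import Order.TTheory GRing.Theory Num.Theory.
Local Open Scope ring_scope.

(* Formal power series over rat: the coefficient of t^n is the value at n. *)
Definition fps := nat -> rat.

Definition fps_cst (c : rat) : fps := fun n => if n == 0%N then c else 0.
Definition fps_X : fps := fun n => if n == 1%N then 1 else 0.
Definition fps_exp : fps := fun n => (n`!%:R)^-1.
Definition fps_add (f g : fps) : fps := fun n => f n + g n.
Definition fps_sub (f g : fps) : fps := fun n => f n - g n.
Definition fps_mul (f g : fps) : fps :=
  fun n => \sum_(i < n.+1) f i * g (n - i)%N.

Definition egf (a : nat -> rat) : fps := fun n => a n / n`!%:R.

(* The series e^t - 1 has no inverse, so t / (e^t - 1) = \sum_n B_n t^n / n!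
   is read in the integral domain of formal power series as
   (\sum_n B_n t^n / n!) (e^t - 1) = t; likewise for 2t / (e^t + 1). *)
Definition bernoulli_spec (B : nat -> rat) : Prop :=
  fps_mul (egf B) (fps_sub fps_exp (fps_cst 1)) =1 fps_X.

(* The generating function starts at n = 1, with the convention G_0 = 0. *)
Definition genocchi_spec (G : nat -> rat) : Prop :=
  G 0%N = 0 /\
  fps_mul (egf G) (fps_add fps_exp (fps_cst 1))
    =1 fps_mul (fps_cst 2) fps_X.

Fixpoint fps_quot_seq (f g : fps) (n : nat) : seq rat :=
  if n is m.+1 then
    let s := fps_quot_seq f g m in
    rcons s ((f m - \sum_(i < m) s`_i * g (m - i)%N) / g 0%N)
  else [::].

Definition fps_quot (f g : fps) : fps := fun n => (fps_quot_seq f g n.+1)`_n.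

Lemma size_fps_quot_seq f g n : size (fps_quot_seq f g n) = n.
Proof. by elim: n => //= n IHn; rewrite size_rcons IHn. Qed.

Lemma nth_fps_quot_seq f g n i :
  (i < n)%N -> (fps_quot_seq f g n)`_i = fps_quot f g i.
Proof.
elim: n => // n IHn; rewrite ltnS leq_eqVlt => /orP[/eqP-> //|lt_in].
by rewrite /= nth_rcons size_fps_quot_seq lt_in IHn.
Qed.

Lemma fps_quotK f g : g 0%N != 0 -> fps_mul (fps_quot f g) g =1 f.
Proof.
move=> g0 n; rewrite /fps_mul big_ord_recr /= subnn {2}/fps_quot /= nth_rcons.
rewrite size_fps_quot_seq ltnn eqxx divfK //.
rewrite [X in f n - X](eq_bigr (fun i : 'I_n => fps_quot f g i * g (n - i)%N)).
  by rewrite addrC subrK.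
by move=> i _; rewrite nth_fps_quot_seq.
Qed.

Lemma fps_mulIf f1 f2 g :
  g 0%N != 0 -> fps_mul f1 g =1 fps_mul f2 g -> f1 =1 f2.
Proof.
move=> g0 eq_fg n; elim/ltn_ind: n => n IHn.
have := eq_fg n; rewrite /fps_mul !big_ord_recr /= subnn.
rewrite (eq_bigr (fun i : 'I_n => f2 i * g (n - i)%N)) => [|i _].
  by move/addrI; apply: mulIf.
by rewrite IHn.
Qed.

Lemma factQ_neq0 n : n`!%:R != 0 :> rat.
Proof. by rewrite pnatr_eq0 -lt0n fact_gt0. Qed.

Lemma egfK (f : fps) : egf (fun n => n`!%:R * f n) =1 f.
Proof. by move=> n; rewrite /egf mulrC mulKf ?factQ_neq0. Qed.

Lemma eq_fps_mull f1 f2 g : f1 =1 f2 -> fps_mul f1 g =1 fps_mul f2 g.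
Proof. by move=> eq_f n; apply: eq_bigr => i _; rewrite eq_f. Qed.

Lemma fps_mul_expm1 f :
  fps_mul f (fps_sub fps_exp (fps_cst 1)) 0%N = 0 /\
  forall n, fps_mul f (fps_sub fps_exp (fps_cst 1)) n.+1 =
            fps_mul f (fun m => fps_exp m.+1) n.
Proof.
have expm1_0 : fps_sub fps_exp (fps_cst 1) 0%N = 0 by [].
split=> [|n]; first by rewrite /fps_mul big_ord1 expm1_0 mulr0.
rewrite /fps_mul big_ord_recr /= subnn expm1_0 mulr0 addr0.
apply: eq_bigr => i _; rewrite subSn -1?ltnS //.
by rewrite /fps_sub /fps_cst /= subr0.
Qed.

Lemma bernoulli_sig : {B : nat -> rat | bernoulli_spec B}.
Proof.
exists (fun n => n`!%:R * fps_quot (fps_cst 1) (fun m => fps_exp m.+1) n).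
move=> n; rewrite (eq_fps_mull _ (egfK _)).
have [mul0 mulS] := fps_mul_expm1 (fps_quot (fps_cst 1) (fun m => fps_exp m.+1)).
by case: n => [|n]; [rewrite mul0 | rewrite mulS fps_quotK].
Qed.

Lemma genocchi_sig : {G : nat -> rat | genocchi_spec G}.
Proof.
pose h := fps_quot (fps_mul (fps_cst 2) fps_X) (fps_add fps_exp (fps_cst 1)).
have hK := @fps_quotK (fps_mul (fps_cst 2) fps_X)
                      (fps_add fps_exp (fps_cst 1)) isT.
exists (fun n => n`!%:R * h n); split; last first.
  by move=> n; rewrite (eq_fps_mull _ (egfK _)) hK.
apply/eqP; rewrite mulf_eq0 (negPf (factQ_neq0 0)) /=.
have /eqP := hK 0%N; rewrite /fps_mul !big_ord1 /= {2}/fps_X /= mulr0.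
by rewrite mulf_eq0 orbF.
Qed.

Definition bernoulli : nat -> rat := sval bernoulli_sig.
Definition genocchi : nat -> rat := sval genocchi_sig.

Lemma bernoulliP : bernoulli_spec bernoulli.
Proof. exact: svalP bernoulli_sig. Qed.

Lemma genocchiP : genocchi_spec genocchi.
Proof. exact: svalP genocchi_sig. Qed.

Lemma egf_inj a b : egf a =1 egf b -> a =1 b.
Proof.
move=> eq_ab n; apply: (mulIf (x := (n`!%:R)^-1)); last exact: eq_ab.
by rewrite invr_eq0 factQ_neq0.
Qed.

Lemma bernoulli_unique B : bernoulli_spec B -> B =1 bernoulli.
Proof.
move=> specB; apply: egf_inj.
apply: (@fps_mulIf _ _ (fun m => fps_exp m.+1)) => // n.
have [_ mulSB] := fps_mul_expm1 (egf B).
have [_ mulSb] := fps_mul_expm1 (egf bernoulli).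
by rewrite -mulSB -mulSb specB bernoulliP.
Qed.

Lemma genocchi_unique G : genocchi_spec G -> G =1 genocchi.
Proof.
move=> [_ specG]; apply: egf_inj.
apply: (@fps_mulIf _ _ (fps_add fps_exp (fps_cst 1))) => // n.
by rewrite specG; have [_ ->] := genocchiP.
Qed.

(* Main.v *)
Require Import Defs.
From mathcomp Require Import all_boot all_order all_algebra.
From mathcomp Require Import ring zify.
Import Order.TTheory GRing.Theory Num.Theory.
Local Open Scope ring_scope.

(** Put u(t) = 1/(e^t - 1) and v(t) = 1/(e^t + 1).  Clearing denominators in
    e^(s+t) = e^s e^t gives the addition formula
      v(s) v(t) + u(s+t) (v(s) + v(t) - 1) = 0.
    Write b_k = B_k/k and g_k = G_k/k.  Then u(w) - 1/w is the exponential
    generating function of b_(k+1), and 2 v(t) that of g_(k+1).  Apply to the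
    formula, at the origin, the differential operator
      P(D_s, D_t)  with  P(x,y) = x^p y^p (x - y)^m,  p = q - 1, m = 2n.
    - On v(s) v(t) it yields one quarter of the second sum.
    - On u(s+t) v(s) the operator D_s acts as x + y and D_t as x, where x
      differentiates u and y differentiates v.  Hence P becomes
      P(x+y, x) = x^p (x+y)^p y^m, which yields half of the first sum;
      u(s+t) v(t) contributes the same, m being even.
    - On u(s+t) alone P acts as P(1,1), which vanishes if m > 0; for m = 0
      the coefficient is b_(2p+1), which vanishes because p > 0.
    - The poles combine into (v(s) + v(t) - 1)/(s+t), a polynomial in each
      degree since 2v - 1 is odd.  In degree 2p + m it is a multiple of the
      alternating sum of the s^i t^j, so P produces a sum of the products
      C(m,i) (p+i)! (p+m-i)!.  That sum is a Beta integral (beta_sum), whence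
      the factor 1/(q C(2q,q)) on the right-hand side (beta_quot).

    The addition formula is proved in one variable z by putting s = cz and
    t = dz (dilate_addition_formula); c = x, d = 1 with x an indeterminate
    separates the two variables again (coef_addition_formula,
    quotient_convolution).  Summing the resulting relations with the
    coefficients of P proves the theorem. *)

(** * Polynomials modulo a power of the variable *)

(** Congruence of power series modulo the M-th power of the variable, for
    representatives that are polynomials, so that identities between series
    reduce to polynomial identities. *)
Definition vanish {A : nzRingType} (M : nat) (p : {poly A}) : Prop :=
  forall i, (i < M)%N -> p`_i = 0.

Lemma vanishD {A : nzRingType} M (p q : {poly A}) :
  vanish M p -> vanish M q -> vanish M (p + q).
Proof. by move=> p0 q0 i iM; rewrite coefD p0 ?q0 ?addr0. Qed.

Lemma vanishMl {A : nzRingType} M (r p : {poly A}) : vanish M p -> vanish M (r * p).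
Proof.
move=> p0 i iM; rewrite coefM big1 // => j _.
by rewrite p0 ?mulr0 // (leq_ltn_trans (leq_subr _ _) iM).
Qed.

Lemma vanishB {A : nzRingType} M (p q : {poly A}) :
  vanish M p -> vanish M q -> vanish M (p - q).
Proof. by move=> p0 q0 i iM; rewrite coefB p0 ?q0 ?subrr. Qed.

(** A series r of order one is a nonzero divisor; cancelling it costs one
    degree of precision. *)
Lemma vanish_cancel {A : idomainType} M (p r : {poly A}) :
  r`_0 = 0 -> r`_1 != 0 -> vanish M.+1 (r * p) -> vanish M p.
Proof.
move=> r0 r1 rp0; elim/ltn_ind=> i IH iM.
have := rp0 i.+1 iM; rewrite coefM 2!big_ord_recl /= r0 mul0r add0r.
rewrite subSS subn0 big1 => [|j _]; last first.
  by rewrite IH ?mulr0 //; move: (ltn_ord j); rewrite /bump /=; lia.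
by rewrite addr0 => /eqP; rewrite mulf_eq0 (negPf r1) => /eqP.
Qed.

Lemma coef_natM {R : nzRingType} (p : {poly R}) k i :
  (k%:R * p)`_i = k%:R * p`_i.
Proof. by rewrite -polyC_natr coefCM. Qed.

Lemma coef_XD1_exp (R : comNzRingType) m i : (('X + 1 : {poly R}) ^+ m)`_i = 'C(m, i)%:R.
Proof.
rewrite exprD1n coef_sum; case: (ltnP i m.+1) => im.
  rewrite (bigD1 (Ordinal im)) //= coefMn coefXn eqxx big1 ?addr0 // => j ji.
  by rewrite coefMn coefXn eq_sym (negPf (ji : (j : nat) != i)) mul0rn.
rewrite bin_small // big1 // => -[j /= jm] _.
by rewrite coefMn coefXn gtn_eqF ?mul0rn // (leq_trans jm).
Qed.

(** * Dilated exponential, Bernoulli and Genocchi series *)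

(** The series f(cz) modulo the M-th power of z.  The dilation factor c is a
    polynomial, so taking it to be an indeterminate x encodes a series in two
    variables s = xz and t = z, graded by total degree. *)
Definition dilate (M : nat) (f : fps) (c : {poly rat}) : {poly {poly rat}} :=
  \poly_(i < M) (f i *: c ^+ i).

Lemma coef_dilate M f c i : (i < M)%N -> (dilate M f c)`_i = f i *: c ^+ i.
Proof. by move=> iM; rewrite coef_poly iM. Qed.

Lemma dilateM M f g h c : fps_mul f g =1 h ->
  vanish M (dilate M f c * dilate M g c - dilate M h c).
Proof.
move=> fgh i iM; apply/eqP; rewrite coefB subr_eq0 coef_dilate // coefM -fgh.
rewrite scaler_suml; apply/eqP/eq_bigr => -[j /= ji] _.
rewrite !coef_dilate; try by lia.
by rewrite -scalerAl -scalerAr scalerA -exprD subnKC // -ltnS.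
Qed.

Lemma dilate_expD M c d :
  vanish M (dilate M fps_exp c * dilate M fps_exp d - dilate M fps_exp (c + d)).
Proof.
move=> i iM; apply/eqP; rewrite coefB subr_eq0 coef_dilate // coefM addrC exprDn.
rewrite scaler_sumr; apply/eqP/eq_bigr => -[j /= ji] _.
rewrite !coef_dilate; try by lia.
rewrite -scalerAl -scalerAr !scalerA [c ^+ j * _]mulrC -scaler_nat scalerA.
congr (_ *: _); rewrite /fps_exp.
have := bin_fact (ji : (j <= i)%N) => /(congr1 (fun k => k%:R : rat)).
rewrite !natrM => <-; field.
by rewrite !factQ_neq0 pnatr_eq0 -lt0n bin_gt0.
Qed.

Lemma dilate_bernoulli M c :
  vanish M.+2 (dilate M.+2 (egf bernoulli) c * (dilate M.+2 fps_exp c - 1)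
           - c%:P * 'X).
Proof.
have e1 : dilate M.+2 fps_exp c - 1 = dilate M.+2 (fps_sub fps_exp (fps_cst 1)) c.
  apply/polyP => i; rewrite coefB coef1 !coef_poly /fps_sub /fps_cst.
  by case: i => [|i] /=; rewrite ?subr0 // expr0 scalerBl scale1r.
have e2 : c%:P * 'X = dilate M.+2 fps_X c.
  apply/polyP => i; rewrite coefMX coefC coef_poly /fps_X.
  by case: i => [|[|i]] //=; rewrite ?scale0r ?scale1r //; case: ifP.
rewrite e1 e2; exact/dilateM/bernoulliP.
Qed.

(** The series 1/(e^t - 1) - 1/t and 2/(e^t + 1). *)
Definition bernoulli_shift : fps := fun n => egf bernoulli n.+1.
Definition genocchi_shift : fps := fun n => egf genocchi n.+1.

Lemma genocchi_shiftP :
  fps_mul genocchi_shift (fps_add fps_exp (fps_cst 1)) =1 fps_cst 2.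
Proof.
move=> n; have [G0 specG] := genocchiP.
have := specG n.+1; rewrite {1}/fps_mul big_ord_recl /= {1}/egf G0 !mul0r add0r.
under eq_bigr => i _ do rewrite /bump add1n subSS.
rewrite /fps_mul => ->; rewrite big_ord_recl /= big1; last first.
  by move=> i _; rewrite /fps_cst /= mul0r.
by rewrite addr0 /fps_cst /fps_X /= subn0; case: n => [|n] /=; rewrite ?mulr1 ?mulr0.
Qed.

Lemma dilate_genocchi M c :
  vanish M.+1 (dilate M.+1 genocchi_shift c * (dilate M.+1 fps_exp c + 1) - 2).
Proof.
have e1 : dilate M.+1 fps_exp c + 1 = dilate M.+1 (fps_add fps_exp (fps_cst 1)) c.
  apply/polyP => i; rewrite coefD coef1 !coef_poly /fps_add /fps_cst.
  by case: i => [|i] /=; rewrite ?addr0 // expr0 scalerDl scale1r.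
have e2 : 2 = dilate M.+1 (fps_cst 2) c :> {poly {poly rat}}.
  apply/polyP => i; rewrite -[2]/(2%:R) -polyC_natr coefC coef_poly /fps_cst.
  case: i => [|i] /=; last by case: ifP; rewrite ?scale0r.
  by rewrite expr0 scaler_nat.
rewrite e1 [X in _ - X]e2; exact/dilateM/genocchi_shiftP.
Qed.

Lemma bernoulli0 : egf bernoulli 0%N = 1.
Proof.
have := bernoulliP 1%N; rewrite /fps_mul big_ord_recr big_ord1 /=.
by rewrite /fps_sub /fps_exp /fps_cst /fps_X /= !subrr mulr0 addr0 subr0 invr1 mulr1.
Qed.

Lemma dilate_bernoulli_shift M c :
  vanish M.+1 (dilate M.+1 (egf bernoulli) c
               - (1 + c%:P * 'X * dilate M.+1 bernoulli_shift c)).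
Proof.
move=> i iM; rewrite coefB coefD coef1 mulrAC coefMX coefCM coef_dilate //.
case: i iM => [|i] iM /=; first by rewrite expr0 bernoulli0 scale1r addr0 subrr.
rewrite coef_dilate; last by lia.
by rewrite -scalerAr -exprS add0r subrr.
Qed.

(** * The addition formula *)

(** The addition formula in the form
      w g(cz) g(dz) + 2 B(w) (g(cz) + g(dz) - 2) = 0,  w = (c + d) z,
    where g(t) = 2/(e^t + 1) and B(w) = w/(e^w - 1).  The left-hand side
    vanishes because it does so after multiplication by
    e^w - 1 = e^(cz) e^(dz) - 1, a series of order one since c + d is nonzero. *)
Lemma dilate_addition_formula M c d : c + d != 0 ->
  let gc := dilate M.+2 genocchi_shift c in
  let gd := dilate M.+2 genocchi_shift d in
  let B := dilate M.+2 (egf bernoulli) (c + d) in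
  vanish M.+1 ((c + d)%:P * 'X * gc * gd + 2 * B * (gc + gd - 2)).
Proof.
move=> cd0 gc gd B.
pose Ec := dilate M.+2 fps_exp c; pose Ed := dilate M.+2 fps_exp d.
pose H := dilate M.+2 fps_exp (c + d); pose w : {poly {poly rat}} := (c + d)%:P * 'X.
have hB : vanish M.+2 (B * (H - 1) - w) := dilate_bernoulli M (c + d).
have hc : vanish M.+2 (gc * (Ec + 1) - 2) := dilate_genocchi M.+1 c.
have hd : vanish M.+2 (gd * (Ed + 1) - 2) := dilate_genocchi M.+1 d.
have hH : vanish M.+2 (Ec * Ed - H) := dilate_expD M.+2 c d.
apply: (@vanish_cancel _ _ _ (H - 1)).
- by rewrite coefB coef1 coef_dilate // expr0 scale1r subrr.
- by rewrite coefB coef1 coef_dilate // subr0 expr1 scale1r.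
(* Each summand is a multiple of one of the four defining congruences. *)
have -> : (H - 1) * (w * gc * gd + 2 * B * (gc + gd - 2)) =
   (2 * (gc + gd - 2)) * (B * (H - 1) - w) - w * gc * gd * (Ec * Ed - H)
   + w * (gd * Ed) * (gc * (Ec + 1) - 2)
   + w * (2 - gc) * (gd * (Ed + 1) - 2) by ring.
by apply: vanishD; [apply: vanishD; [apply: vanishB|]|]; apply: vanishMl.
Qed.

Lemma dilate_exp0 M : dilate M.+1 fps_exp 0 = 1.
Proof.
apply/polyP => -[|i]; rewrite coef_poly coef1 /=.
  by rewrite expr0 /fps_exp invr1 scale1r.
by rewrite expr0n scaler0; case: ifP.
Qed.

(** Since B(z) = z/(e^z - 1) satisfies B(-z) = B(z) + z, its odd coefficients
    beyond the first vanish. *)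
Lemma bernoulli_odd k : odd k -> (1 < k)%N -> bernoulli k = 0.
Proof.
move=> odd_k k_gt1.
pose E := dilate k.+2 fps_exp 1; pose E' := dilate k.+2 fps_exp (-1).
pose B := dilate k.+2 (egf bernoulli) 1.
pose B' := dilate k.+2 (egf bernoulli) (-1).
have hB : vanish k.+2 (B * (E - 1) - 1%:P * 'X) := dilate_bernoulli k 1.
have hB' : vanish k.+2 (B' * (E' - 1) - (- 1)%:P * 'X) := dilate_bernoulli k (-1).
have hE : vanish k.+2 (E * E' - 1).
  by rewrite -(dilate_exp0 k.+1) -[0](subrr 1); apply: dilate_expD.
have : vanish k.+1 (B' - B - 'X).
  apply: (@vanish_cancel _ _ _ (E - 1)).
  - by rewrite coefB coef1 coef_dilate // expr0 scale1r subrr.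
  - by rewrite coefB coef1 coef_dilate // subr0 expr1 scale1r oner_neq0.
  have -> : (E - 1) * (B' - B - 'X) = B' * (E * E' - 1)
      - E * (B' * (E' - 1) - (- 1)%:P * 'X) - 1 * (B * (E - 1) - 1%:P * 'X).
    by rewrite polyCN polyC1; ring.
  by apply: vanishB; [apply: vanishB|]; apply: vanishMl.
move=> /(_ k (ltnSn k)); rewrite !coefB coefX !coef_dilate ?ltnS ?leqnSn //.
rewrite -signr_odd odd_k expr1 expr1n scalerN gtn_eqF // subr0.
move=> /eqP; rewrite -opprD oppr_eq0 -scalerDl scaler_eq0 oner_eq0 orbF.
rewrite -mulr2n mulrn_eq0 /= mulf_eq0 invr_eq0 => /orP[/eqP-> //|].
by rewrite (negPf (factQ_neq0 k)).
Qed.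

Definition bernoulli_quot (k : nat) : rat := bernoulli k / k%:R.
Definition genocchi_quot (k : nat) : rat := genocchi k / k%:R.

Lemma bernoulli_shiftE k : bernoulli_shift k = bernoulli_quot k.+1 / k`!%:R.
Proof.
rewrite /bernoulli_shift /egf /bernoulli_quot factS natrM; field.
by rewrite factQ_neq0 nat1r pnatr_eq0.
Qed.

Lemma genocchi_shiftE k : genocchi_shift k = genocchi_quot k.+1 / k`!%:R.
Proof.
rewrite /genocchi_shift /egf /genocchi_quot factS natrM; field.
by rewrite factQ_neq0 nat1r pnatr_eq0.
Qed.

(** The quotient of x^(N+1) + y^(N+1) by x + y for y = 1: this divides the
    pole w = s + t out of the odd part of 2/(e^s + 1) + 2/(e^t + 1). *)
Lemma alternating_geometric {A : comNzRingType} (N : nat) (x : A) : ~~ odd N ->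
  x ^+ N.+1 + 1 = (x + 1) * \sum_(i < N.+1) (- x) ^+ i.
Proof.
move=> evN; have := subrX1 (- x) N.+1.
rewrite exprNn exprS -signr_odd (negPf evN) expr0 mulr1 => h.
by rewrite -[LHS]opprK opprD -[- x ^+ _]mulN1r h -mulNr opprD !opprK.
Qed.

(** The part of total degree N of the addition formula divided by w = s + t,
    at s = xz and t = z; after substituting B(w) = 1 + w (1/(e^w - 1) - 1/w),
    it is read off from the coefficient of z^(N+1), and the factor x + 1 is
    cancelled. *)
Lemma coef_addition_formula (N : nat) : ~~ odd N ->
  \sum_(j < N.+1) (genocchi_shift j * genocchi_shift (N - j)%N) *: 'X^j
  + 2 * \sum_(j < N.+1) (genocchi_shift j * bernoulli_shift (N - j)%N)
           *: ('X^j * ('X + 1) ^+ (N - j))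
  + 2 * \sum_(j < N.+1) (genocchi_shift j * bernoulli_shift (N - j)%N)
           *: ('X + 1) ^+ (N - j)
  = 4 * (bernoulli_shift N *: ('X + 1) ^+ N)
    - 2 * (genocchi_shift N.+1 *: \sum_(i < N.+1) (- 'X) ^+ i) :> {poly rat}.
Proof.
move=> evN.
have X1 : 'X + 1 != 0 :> {poly rat} by rewrite -[1]/(1%:P) monic_neq0 ?monicXaddC.
have := @dilate_addition_formula N.+1 'X 1 X1.
set gc := dilate _ _ 'X; set gd := dilate _ _ 1; set B := dilate _ _ _ => /= rel.
pose b := dilate N.+3 bernoulli_shift ('X + 1).
have hB : vanish N.+2 (B - (1 + ('X + 1)%:P * 'X * b)).
  by move=> i iN; apply: (@dilate_bernoulli_shift N.+2); lia.
have : vanish N.+2 (('X + 1)%:P * (gc * gd + 2 * (gc * b) + 2 * (gd * b) - 4 * b) * 'X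
            + 2 * (gc + gd - 2)).
  have -> : ('X + 1)%:P * (gc * gd + 2 * (gc * b) + 2 * (gd * b) - 4 * b) * 'X
            + 2 * (gc + gd - 2) =
     ((('X + 1)%:P * 'X * gc * gd + 2 * B * (gc + gd - 2)))
     - (2 * (gc + gd - 2)) * (B - (1 + ('X + 1)%:P * 'X * b)) by ring.
  by apply: vanishB => //; apply: vanishMl.
move=> /(_ N.+1 (ltnSn _)); rewrite coefD coefMX /= coefCM (@coef_natM {poly rat} _ 2).
rewrite !(coefB, coefD) !(@coef_natM {poly rat} _ 2)
        !(@coef_natM {poly rat} _ 4).
rewrite !coef1 /= addr0 subr0.
rewrite [gc`_N.+1]coef_dilate; last by lia.
rewrite [gd`_N.+1]coef_dilate; last by lia.
rewrite [b`_N]coef_dilate; last by lia.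
rewrite expr1n -scalerDr alternating_geometric //.
rewrite [in X in X -> _]scalerAr [in X in X -> _]mulrCA -mulrDr.
move=> /eqP; rewrite mulf_eq0 (negPf X1) /= => /eqP.
have -> : (gc * gd)`_N = \sum_(j < N.+1)
    (genocchi_shift j * genocchi_shift (N - j)%N) *: 'X^j.
  rewrite coefM; apply: eq_bigr => -[j /= jN] _; rewrite !coef_dilate; try by lia.
  by rewrite expr1n -scalerAl -scalerAr mulr1 scalerA.
have -> : (gc * b)`_N = \sum_(j < N.+1)
    (genocchi_shift j * bernoulli_shift (N - j)%N) *: ('X^j * ('X + 1) ^+ (N - j)).
  rewrite coefM; apply: eq_bigr => -[j /= jN] _; rewrite !coef_dilate; try by lia.
  by rewrite -scalerAl -scalerAr scalerA.
have -> : (gd * b)`_N = \sum_(j < N.+1)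
    (genocchi_shift j * bernoulli_shift (N - j)%N) *: ('X + 1) ^+ (N - j).
  rewrite coefM; apply: eq_bigr => -[j /= jN] _; rewrite !coef_dilate; try by lia.
  by rewrite expr1n -scalerAl -scalerAr mul1r scalerA.
set S1 := (\sum_(j < N.+1) _ *: 'X^j); set S2 := (\sum_(j < N.+1) _ *: (_ * _)).
set S3 := (\sum_(j < N.+1) _ *: _ ^+ (N - j)).
move: S1 S2 S3 (bernoulli_shift N *: _) (genocchi_shift N.+1 *: _).
move=> S1 S2 S3 T U eq0; apply/eqP; rewrite -subr_eq0 -[X in _ == X]eq0; apply/eqP.
by ring.
Qed.

Lemma natr_fact_bin a k : (k <= a)%N ->
  'C(a, k)%:R = a`!%:R / (k`!%:R * (a - k)`!%:R) :> rat.
Proof.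
move=> ka; rewrite -(bin_fact ka) !natrM mulfK //.
by rewrite mulf_neq0 ?factQ_neq0.
Qed.

(** The coefficient of x^a in the preceding identity, that is of s^a t^b in
    the addition formula, multiplied by a! b!: the binomials come from
    applying Leibniz' rule to u(s+t) v(s) and u(s+t) v(t). *)
Lemma quotient_convolution (a b : nat) : ~~ odd (a + b) ->
  genocchi_quot a.+1 * genocchi_quot b.+1
  + 2 * \sum_(j < (a + b).+1)
      'C(a, j)%:R * (bernoulli_quot (a + b - j).+1 * genocchi_quot j.+1)
  + 2 * \sum_(j < (a + b).+1)
      'C(b, j)%:R * (bernoulli_quot (a + b - j).+1 * genocchi_quot j.+1)
  = 4 * bernoulli_quot (a + b).+1
    - 2 * (-1) ^+ a * (a`!%:R * b`!%:R / (a + b).+1`!%:R) * genocchi_quot (a + b).+2.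
Proof.
move=> ev; have := congr1 (fun p : {poly rat} => p`_a) (coef_addition_formula _ ev).
have aN : (a < (a + b).+1)%N by lia.
rewrite coefB !coefD !(coef_natM _ 2) (coef_natM _ 4) !coefZ !coef_sum coef_XD1_exp.
have -> : \sum_(j < (a + b).+1)
   ((genocchi_shift j * genocchi_shift (a + b - j)%N) *: 'X^j : {poly rat})`_a
   = genocchi_quot a.+1 * genocchi_quot b.+1 / (a`!%:R * b`!%:R).
  rewrite (bigD1 (Ordinal aN)) //= coefZ coefXn eqxx big1 ?addr0 => [|j ja].
    by rewrite addKn !genocchi_shiftE mulr1; field; rewrite !factQ_neq0.
  by rewrite coefZ coefXn eq_sym (negPf (ja : (j : nat) != a)) mulr0.
have -> : \sum_(j < (a + b).+1)
   ((genocchi_shift j * bernoulli_shift (a + b - j)%N) *: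
        ('X^j * ('X + 1) ^+ (a + b - j)) : {poly rat})`_a
   = (\sum_(j < (a + b).+1)
      'C(a, j)%:R * (bernoulli_quot (a + b - j).+1 * genocchi_quot j.+1))
     / (a`!%:R * b`!%:R).
  rewrite mulr_suml; apply: eq_bigr => -[j /= jN] _.
  rewrite coefZ coefXnM; case: ltnP => ja; first by rewrite bin_small // mulr0 !mul0r.
  rewrite coef_XD1_exp !natr_fact_bin //; last by lia.
  rewrite genocchi_shiftE bernoulli_shiftE.
  have -> : (a + b - j - (a - j))%N = b by lia.
  by field; rewrite !factQ_neq0.
have -> : \sum_(j < (a + b).+1)
   ((genocchi_shift j * bernoulli_shift (a + b - j)%N) *:
        ('X + 1) ^+ (a + b - j) : {poly rat})`_a
   = (\sum_(j < (a + b).+1)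
      'C(b, j)%:R * (bernoulli_quot (a + b - j).+1 * genocchi_quot j.+1))
     / (a`!%:R * b`!%:R).
  rewrite mulr_suml; apply: eq_bigr => -[j /= jN] _.
  rewrite coefZ coef_XD1_exp; case: (leqP j b) => jb; last first.
    by rewrite !bin_small // ?mulr0 ?mul0r //; lia.
  rewrite !natr_fact_bin //; last by lia.
  rewrite genocchi_shiftE bernoulli_shiftE.
  have -> : (a + b - j - a = b - j)%N by lia.
  by field; rewrite !factQ_neq0.
have -> : \sum_(j < (a + b).+1) ((- 'X : {poly rat}) ^+ j)`_a = (-1) ^+ a.
  rewrite (bigD1 (Ordinal aN)) //= big1 ?addr0 => [|j ja].
    by rewrite -scaleN1r exprZn coefZ coefXn eqxx mulr1.
  rewrite -scaleN1r exprZn coefZ coefXn eq_sym.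
  by rewrite (negPf (ja : (j : nat) != a)) mulr0.
rewrite natr_fact_bin ?leq_addr // addKn genocchi_shiftE bernoulli_shiftE.
move=> /(congr1 (fun x => x * (a`!%:R * b`!%:R))) h.
apply: etrans (etrans h _); first by field; rewrite !factQ_neq0.
by field; rewrite !factQ_neq0.
Qed.

(** * Binomial sums *)

Lemma pascal_sum (m : nat) (F : nat -> nat -> rat) :
  \sum_(i < m.+2) 'C(m.+1, i)%:R * F i (m.+1 - i)%N
  = \sum_(i < m.+1) 'C(m, i)%:R * (F i (m - i).+1 + F i.+1 (m - i)%N).
Proof.
rewrite big_ord_recl /=.
under eq_bigr => i _ do rewrite binS natrD mulrDl subSS.
rewrite big_split /= addrA.
under [in RHS]eq_bigr => i _ do rewrite mulrDr.
rewrite big_split /=; congr (_ + _).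
rewrite bin0 -(bin0 m).
rewrite -(big_ord_recl m.+1 (fun i : 'I_m.+2 => 'C(m, i)%:R * F i (m.+1 - i)%N)).
rewrite big_ord_recr /= bin_small // mul0r addr0.
by apply: eq_bigr => -[i /= im] _; rewrite subSn.
Qed.

Lemma binomial_sum_widen (p K : nat) (c : nat -> rat) : (p <= K)%N ->
  \sum_(j < K.+1) 'C(p, j)%:R * c j = \sum_(j < p.+1) 'C(p, j)%:R * c j.
Proof.
move=> pK; rewrite (@big_ord_widen _ _ _ p.+1 K.+1 (fun j => 'C(p, j)%:R * c j)) //.
rewrite [RHS]big_mkcond.
by apply: eq_bigr => j _; case: ltnP => // pj; rewrite bin_small ?mul0r.
Qed.

(** This is (x+1)^p (1 - (x+1))^m = (-x)^m (x+1)^p, with x^j replaced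
    by c_j. *)
Lemma alternating_binomial_shift (m p K : nat) (c : nat -> rat) :
  (p + m <= K)%N ->
  \sum_(i < m.+1) (-1) ^+ i * 'C(m, i)%:R * \sum_(j < K.+1) 'C(p + i, j)%:R * c j
  = (-1) ^+ m * \sum_(k < p.+1) 'C(p, k)%:R * c (m + k)%N.
Proof.
pose A p := \sum_(j < K.+1) 'C(p, j)%:R * c j.
under eq_bigr => i _ do rewrite [_ * 'C(m, i)%:R]mulrC -mulrA -/(A (p + i)%N).
elim: m p => [|m IH] p pK.
  by rewrite big_ord1 !mul1r addn0 /A binomial_sum_widen -1?[p in (p <= _)%N]addn0.
rewrite (pascal_sum m (fun i _ => (-1) ^+ i * A (p + i)%N)).
under eq_bigr => i _ do rewrite mulrDr exprS mulN1r mulNr mulrN -addSnnS.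
rewrite big_split sumrN /= !IH; try by lia.
rewrite -mulrBr exprS mulN1r mulNr -mulrN; congr (_ * _).
rewrite (pascal_sum p (fun k _ => c (m + k)%N)).
under [in X in _ - X]eq_bigr => i _ do rewrite mulrDr.
rewrite big_split /= opprD addrA subrr add0r; congr (- _).
by apply: eq_bigr => k _; rewrite addnS addSn.
Qed.

(** Since a! b!/(a+b+1)! is the integral of x^a (1-x)^b over [0,1], this is
    the integral of x^p (1-x)^r (x + (1-x))^m. *)
Lemma beta_sum (m p r : nat) :
  \sum_(i < m.+1) 'C(m, i)%:R * ((p + i)`!%:R * (r + (m - i))`!%:R)
  = p`!%:R * r`!%:R * (p + r + m).+1`!%:R / (p + r).+1`!%:R :> rat.
Proof.
elim: m p r => [|m IH] p r.
  by rewrite big_ord1 bin0 !addn0 mul1r mulfK ?factQ_neq0.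
rewrite (pascal_sum m (fun i j => (p + i)`!%:R * (r + j)`!%:R)).
under eq_bigr => i _ do rewrite mulrDr -[(r + _.+1)%N]addSnnS -[(p + _.+1)%N]addSnnS.
rewrite big_split /= !IH !addSn !addnS.
rewrite (factS p) (factS r) addSn (factS (p + r).+1) !natrM.
have S0 k : k.+1%:R != 0 :> rat by rewrite pnatr_eq0.
have -> : (p + r).+2%:R = p.+1%:R + r.+1%:R :> rat by rewrite -natrD addSn addnS.
field.
by rewrite factQ_neq0 !nat1r -!natrD nat1r !pnatr_eq0.
Qed.

Lemma beta_quot (p : nat) :
  p`!%:R * p`!%:R / (p + p).+1`!%:R = 2 / (p.+1%:R * 'C(2 * p.+1, p.+1)%:R) :> rat.
Proof.
rewrite natr_fact_bin; last by lia.
have -> : (2 * p.+1 - p.+1 = p.+1)%N by lia.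
have -> : (2 * p.+1 = (p + p).+2)%N by lia.
have S0 k : k.+1%:R != 0 :> rat by rewrite pnatr_eq0.
rewrite !factS !natrM.
have -> : (p + p).+2%:R = 2 * p.+1%:R :> rat by rewrite -natrM; congr _%:R; lia.
move: (S0 p) (S0 (p + p)%N) (factQ_neq0 p) (factQ_neq0 (p + p)%N).
move: p.+1%:R (p + p).+1%:R p`!%:R (p + p)`!%:R => x y z t x0 y0 z0 t0.
by field; apply/and4P.
Qed.

(** * The convolution identity *)

Theorem theorem5p2 (n q : nat) (hq : (2 <= q)%N) :
  \sum_(0 <= i < q)
     'C(q.-1, i)%:R *
     ((bernoulli (q + i)%N * genocchi (2 * n + q - i)%N)
      / ((q + i)%N%:R * (2 * n + q - i)%N%:R))
  + 1 / 4 *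
    \sum_(0 <= i < (2 * n).+1)
       (-1) ^+ i * 'C(2 * n, i)%:R *
       ((genocchi (q + i)%N * genocchi (2 * n + q - i)%N)
        / ((q + i)%N%:R * (2 * n + q - i)%N%:R))
  = (-1) ^+ q / (q%:R * 'C(2 * q, q)%:R)
    * (genocchi (2 * n + 2 * q)%N / (2 * n + 2 * q)%N%:R) :> rat.
Proof.
case: q hq => // p p_gt0; rewrite !big_mkord /=.
set m := (2 * n)%N; have ev_m : ~~ odd m by rewrite /m mul2n odd_double.
have sgn_m : (-1) ^+ m = 1 :> rat by rewrite -signr_odd (negPf ev_m).
pose N := (p + p + m)%N.
have ev_N : ~~ odd N by rewrite /N oddD addnn odd_double.
pose c j := bernoulli_quot (N - j).+1 * genocchi_quot j.+1.
pose T := \sum_(k < p.+1) 'C(p, k)%:R * c (m + k)%N.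
have eqT : \sum_(i < p.+1) 'C(p, i)%:R *
     ((bernoulli (p.+1 + i)%N * genocchi (m + p.+1 - i)%N)
      / ((p.+1 + i)%N%:R * (m + p.+1 - i)%N%:R)) = T.
  rewrite [RHS](reindex_inj rev_ord_inj) /=; apply: eq_bigr => -[i /= ip] _.
  rewrite subSS bin_sub // /c /bernoulli_quot /genocchi_quot mulf_div.
  have -> : (N - (m + (p - i))).+1 = (p.+1 + i)%N by rewrite /N; lia.
  by have -> : (m + (p - i)).+1 = (m + p.+1 - i)%N by lia.
rewrite {}eqT.
(* Twice the derivative, of order d in s and N - d in t, of u(s+t) v(s) at
   the origin, after removal of the pole of u. *)
pose A d := \sum_(j < N.+1) 'C(d, j)%:R * c j.
have sumA : \sum_(i < m.+1) (-1) ^+ i * 'C(m, i)%:R * A (p + i)%N = T.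
  by rewrite alternating_binomial_shift ?sgn_m ?mul1r // /N; lia.
have sumA' : \sum_(i < m.+1) (-1) ^+ i * 'C(m, i)%:R * A (p + (m - i))%N = T.
  rewrite -[RHS]sumA [RHS](reindex_inj rev_ord_inj) /=; apply: eq_bigr => -[i /= im] _.
  rewrite subSS bin_sub //; congr (_ * _ * _).
  by rewrite -[LHS]signr_odd -[RHS]signr_odd oddB // (negPf ev_m).
have rel (i : 'I_m.+1) :
  (-1) ^+ i * 'C(m, i)%:R *
       ((genocchi (p.+1 + i)%N * genocchi (m + p.+1 - i)%N)
        / ((p.+1 + i)%N%:R * (m + p.+1 - i)%N%:R))
  = 4 * bernoulli_quot N.+1 * ((-1) ^+ i * 'C(m, i)%:R)
    - 2 * (-1) ^+ p * genocchi_quot N.+2 / N.+1`!%:R *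
      ('C(m, i)%:R * ((p + i)`!%:R * (p + (m - i))`!%:R))
    - 2 * ((-1) ^+ i * 'C(m, i)%:R * A (p + i)%N)
    - 2 * ((-1) ^+ i * 'C(m, i)%:R * A (p + (m - i))%N).
  case: i => i /= im.
  have abN : (p + i + (p + (m - i)) = N)%N by rewrite /N; lia.
  have := quotient_convolution (p + i) (p + (m - i)); rewrite abN => /(_ ev_N).
  rewrite -/(A _) -/(A _) -mulf_div.
  have -> : (p.+1 + i = (p + i).+1)%N by [].
  have -> : (m + p.+1 - i = (p + (m - i)).+1)%N by lia.
  rewrite -/(genocchi_quot _) -/(genocchi_quot _).
  move=> /(canRL (addrK _)) /(canRL (addrK _)) ->.
  have -> : (-1) ^+ (p + i) = (-1) ^+ p * (-1) ^+ i :> rat by rewrite exprD.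
  have s2 : (-1) ^+ i * (-1) ^+ i = 1 :> rat by rewrite -expr2 sqrr_sign.
  (* The factorial term carries the sign of i twice: once from P and once
     from the quotient by s + t. *)
  move: ((-1) ^+ i) s2 => s s2.
  by rewrite -[X in _ = _ - X * _ * _ / _ * _ - _ - _]mulr1 -s2; ring.
under [X in 1 / 4 * X]eq_bigr => i _ do rewrite rel.
rewrite !sumrB -!mulr_sumr sumA sumA' beta_sum.
rewrite -[4 * _ * _]mulrA.
have -> : bernoulli_quot N.+1 * (\sum_(i < m.+1) (-1) ^+ i * 'C(m, i)%:R) = 0.
  (* The alternating sum is P(1,1); it is 1 when m = 0. *)
  have [m0 | m_gt0] := posnP m.
    rewrite /bernoulli_quot bernoulli_odd ?mul0r //= ?ev_N //.
    by rewrite /N m0; lia.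
  have := exprBn (1 : rat) 1 m; rewrite subrr expr0n gtn_eqF //= => sum0.
  rewrite [X in _ * X](_ : _ = 0) ?mulr0 // [RHS]sum0.
  by apply: eq_bigr => i _; rewrite !expr1n !mulr1 mulr_natr.
have -> : (m + 2 * p.+1 = N.+2)%N by rewrite /N; lia.
rewrite -/(genocchi_quot _) exprS.
have -> : (p.+1%:R * 'C(2 * p.+1, p.+1)%:R)^-1 =
   p`!%:R * p`!%:R / (p + p).+1`!%:R / 2 :> rat.
  by rewrite beta_quot mulrAC divff // mul1r.
by field; rewrite !factQ_neq0.
Qed.
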